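(* Let $X$ be a connected manifold with corners of codimension $d$. The identity map $(\mathcal C_*(X),\delta^1)\longrightarrow(\mathcal C_*(X),\delta^{\mathrm{pcn}})$ induces an isomorphism between the $\mathbb Z_2$-graded homology groups.
   Context: Manifold with corners: a Hausdorff space $X$ contained in a smooth manifold $\tilde X$ of the same dimension, with finitely many connected boundary hyperfaces $H_1,\dots,H_N$ and defining functions $r_1,\dots,r_N\in C^\infty(\tilde X)$, such that $X=\bigcap_j\{r_j\ge 0\}$, $H_j=X\cap\{r_j=0\}$, and for every subset $J$ of indices the $dr_j$, $j\in J$, are linearly independent at every point of $\bigcap_{j\in J}\{r_j=0\}$. An open face of codimension $p$ is a connected component of the set of points of $X$ at which exactly $p$ of the $r_j$ vanish; $F_p$ is the set of these faces. The codimension $d$ of $X$ is the largest $p$ with $F_p\neq\emptyset$. Put $e_j=dr_j$. If $f\in F_p$ lies in $H_I=H_{i_1}\cap\dots\cap H_{i_p}$, $I=(i_1<\dots<i_p)$, the conormal bundle $N(f)$ has the global basis $(e_i)_{i\in I}$ and its orientations are $\pm e_I$, $e_I=e_{i_1}\wedge\dots\wedge e_{i_p}$. $C_p(X)$ is the free $\mathbb Z$-module generated by the symbols $f\otimes\varepsilon$, $f\in F_p$, $\varepsilon$ an orientation of $N(f)$, with $f\otimes(-\varepsilon)=-(f\otimes\varepsilon)$; $\mathcal C(X)=\mathcal C_*(X)=\bigoplus_p C_p(X)$, with the $\mathbb Z_2$-grading given by the parity of $p$. Contraction: $e_i\lrcorner e_I=0$ if $i\notin I$, $e_i\lrcorner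 e_I=(-1)^{j-1}e_{I\setminus\{i\}}$ if $i$ is the $j$-th coordinate of $I$, and $e_J\lrcorner\,\cdot=e_{j_1}\lrcorner(\cdots\lrcorner(e_{j_k}\lrcorner\,\cdot)\cdots)$ for $J=(j_1<\dots<j_k)$. For $f\in F_p$ and $g\in F_{p-k}$ with $f\subset\overline g$, $(g,f)$ denotes the increasing $k$-tuple of indices of the defining functions whose vanishing characterizes $f$ in $\overline g$. For $0\le k\le p$ set $\delta^k_p:C_p(X)\to C_{p-k}(X)$, $\delta^k_p(f\otimes\varepsilon)=\sum_{g\in F_{p-k},\,f\subset\overline g}g\otimes e_{(g,f)}\lrcorner\varepsilon$, and let $\delta^k=\sum_p\delta^k_p$ (with $\delta^k_p=0$ if $k>p$). Let $\delta^{\mathrm{pcn}}=\sum_{k\ge0}\delta^{2k+1}$. Both $\delta^1$ and $\delta^{\mathrm{pcn}}$ are differentials (square to zero) of degree $1$ for the $\mathbb Z_2$-grading. ''Induces'' means that the identity carries cycles to cycles and boundaries to boundaries, hence passes to homology. *)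

(* Defs.v *)
From HB Require Import structures.
From mathcomp Require Import all_boot all_order all_algebra.
From mathcomp Require Import all_classical all_reals all_analysis.
From mathcomp Require Import freeg.

Set Implicit Arguments.
Unset Strict Implicit.
Unset Printing Implicit Defensive.

Import Order.TTheory GRing.Theory Num.Theory.
Import numFieldNormedType.Exports.

Local Open Scope classical_set_scope.
Local Open Scope ring_scope.
Local Open Scope quotient_scope.

Section Smooth.
Context {R : realType} {n : nat}.

Definition dirvec (i : 'I_n) : 'rV[R]_n := delta_mx 0 i.

(* All iterated partial derivatives of order <= k exist and are continuous at
   the points of U.  Only meant for open U. *)
Fixpoint Ck_on (k : nat) (U : set 'rV[R]_n) (f : 'rV[R]_n -> R) : Prop :=
  (forall x, U x -> {for x, continuous f}) /\
  match k with
  | 0 => True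
  | k'.+1 => forall i : 'I_n,
      (forall x, U x -> derivable f x (dirvec i)) /\
      Ck_on k' U (fun x => 'D_(dirvec i) f x)
  end.

Definition smooth_on (U : set 'rV[R]_n) (f : 'rV[R]_n -> R) : Prop :=
  forall k, Ck_on k U f.

Definition smooth_map_on (U : set 'rV[R]_n) (F : 'rV[R]_n -> 'rV[R]_n) : Prop :=
  forall i : 'I_n, smooth_on U (fun x => F x 0 i).

End Smooth.

(* A homeomorphism from an open subset of M onto an open subset of R^n.  The
   values of [cmap] off [cdom], and of [cinv] off the image, are irrelevant. *)
Record chart (R : realType) (n : nat) (M : topologicalType) := Chart {
  cdom : set M;
  cmap : M -> 'rV[R]_n;
  cinv : 'rV[R]_n -> M;
  cdom_open : open cdom;
  cimg_open : open (cmap @` cdom);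
  cmapK : forall x, cdom x -> cinv (cmap x) = x;
  cmap_continuous : {within cdom, continuous cmap};
  cinv_continuous : {within cmap @` cdom, continuous cinv}
}.

(* The atlas need not be maximal. *)
Record smoothManifold (R : realType) (n : nat) := SmoothManifold {
  carrier :> topologicalType;
  carrier_hausdorff : hausdorff_space carrier;
  carrier_second_countable : @second_countable carrier;
  atlas : set (chart R n carrier);
  atlas_cover : forall x : carrier, exists2 c, atlas c & cdom c x;
  atlas_compatible : forall c1 c2, atlas c1 -> atlas c2 ->
    smooth_map_on (cmap c1 @` (cdom c1 `&` cdom c2)) (cmap c2 \o cinv c1)
}.

Section SmoothFunctions.
Context {R : realType} {n : nat} (M : smoothManifold R n).

Definition smooth_fun (f : M -> R) : Prop :=
  forall c, atlas c -> smooth_on (cmap c @` cdom c) (f \o cinv c).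

(* The coordinates of df(x) in the basis of the cotangent space at x given by
   the chart c. *)
Definition differential_in (c : chart R n M) (f : M -> R) (x : M) : 'rV[R]_n :=
  \row_i 'D_(dirvec i) (f \o cinv c) (cmap c x).

Definition differentials_free (N : nat) (r : 'I_N -> M -> R)
    (J : {set 'I_N}) (x : M) : Prop :=
  forall c, atlas c -> cdom c x ->
    free [seq differential_in c (r j) x | j <- enum J].

Definition corner_locus (N : nat) (r : 'I_N -> M -> R) : set M :=
  [set x | forall j, 0 <= r j x].

Definition corner_hyperface (N : nat) (r : 'I_N -> M -> R) (j : 'I_N) : set M :=
  corner_locus r `&` [set x | r j x = 0].

End SmoothFunctions.

Record manifoldWithCorners (R : realType) (n : nat) := ManifoldWithCorners {
  ambient : smoothManifold R n;
  nhyp : nat;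
  rho : 'I_nhyp -> ambient -> R;
  rho_smooth : forall j, smooth_fun (rho j);
  hyperface_connected : forall j, connected (corner_hyperface rho j);
  rho_independent : forall (J : {set 'I_nhyp}) (x : ambient),
    (forall j, j \in J -> rho j x = 0) -> differentials_free rho J x
}.

Section Faces.
Context {R : realType} {n : nat} (X : manifoldWithCorners R n).

Definition points : set (ambient X) := corner_locus (@rho R n X).

Definition hyperface (j : 'I_(nhyp X)) : set (ambient X) :=
  corner_hyperface (@rho R n X) j.

Definition stratum (p : nat) : set (ambient X) :=
  [set x | points x /\ #|[pred j | rho j x == 0]| = p].

(* F_p *)
Definition open_faces (p : nat) : set (set (ambient X)) :=
  [set A | exists2 x, stratum p x & A = connected_component (stratum p) x].

Definition has_codimension (d : nat) : Prop :=
  open_faces d !=set0 /\ forall p, open_faces p !=set0 -> (p <= d)%N.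

(* Open faces of all codimensions, tagged by their codimension. *)
Definition face : choiceType := {p : nat & open_faces p}.

Definition Face (p : nat) (A : open_faces p) : face :=
  Tagged (fun p => open_faces p : Type) A.

Definition codim (f : face) : nat := tag f.

Definition face_set (f : face) : set (ambient X) := val (tagged f).

Definition face_index (f : face) : {set 'I_(nhyp X)} :=
  [set i | `[< face_set f `<=` hyperface i >]]%SET.

End Faces.
Arguments points {R n} X.
Arguments hyperface {R n} X j.
Arguments stratum {R n} X p.
Arguments open_faces {R n} X p.

Section Exterior.
Context {N : nat}.

(* The function eps stands for \sum_I (eps I) e_I. *)
Definition ext : zmodType := {ffun {set 'I_N} -> int}.

Definition eI (I : {set 'I_N}) : ext := [ffun J : {set 'I_N} => (J == I)%:Z].

(* [index i (enum I)] is 0 for the first element of I. *)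
Definition contract1 (i : 'I_N) (eps : ext) : ext :=
  \sum_(I : {set 'I_N} | i \in I)
    eI (I :\ i)%SET *~ ((-1) ^+ index i (enum I) * eps I).

(* [enum J] is increasing; its last element is contracted first. *)
Definition contract (J : {set 'I_N}) (eps : ext) : ext :=
  foldr contract1 eps (enum J).

Lemma contractN J (eps : ext) : contract J (- eps) = - contract J eps.
Proof.
rewrite /contract; elim: (enum J) => //= i s ->; rewrite /contract1 -sumrN.
by apply: eq_bigr => I _; rewrite ffunE mulrN mulrNz.
Qed.

End Exterior.
Arguments ext : clear implicits.

Lemma fsumrN (I : choiceType) (V : zmodType) (A : set I) (F : I -> V) :
  \sum_(i \in A) - F i = - \sum_(i \in A) F i.
Proof.
have E : finite_support 0 A (fun i => - F i) = finite_support 0 A F.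
  rewrite /finite_support !unlock.
  suff -> : (fun i => - F i) @^-1` [set~ 0] = F @^-1` [set~ 0] by [].
  apply/seteqP; split=> i /= Fi0 F0; apply: Fi0; first by rewrite F0 oppr0.
  by apply/eqP; rewrite -oppr_eq0 F0.
by rewrite -sumrN E.
Qed.

Section Chains.
Context {R : realType} {n : nat} (X : manifoldWithCorners R n).
Local Notation N := (nhyp X).
Local Notation face := (face X).

(* C(X).  The module generated by the f (x) eps subject to
   f (x) (- eps) = - (f (x) eps) is free on the f (x) e_I, I = face_index f;
   <<f>> stands for f (x) e_I. *)
Definition chains : zmodType := {freeg face / int}.

Definition orientation (f : face) (eps : ext N) : Prop :=
  eps = eI (face_index f) \/ eps = - eI (face_index f).

Definition symbol (f : face) (eps : ext N) : chains :=
  << f >> *~ eps (face_index f).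

(* (g, f) *)
Definition face_gap (g f : face) : {set 'I_N} :=
  (face_index f :\: face_index g)%SET.

(* The sum is over finitely many g: near a point of f, a face g with f in its
   closure is determined by its set of indices, which is contained in that
   of f. *)
Definition delta_symbol (k : nat) (f : face) (eps : ext N) : chains :=
  if (k <= codim f)%N then
    \sum_(g \in [set g : open_faces X (codim f - k) |
                  face_set f `<=` closure (val g)])
      symbol (Face g) (contract (face_gap (Face g) f) eps)
  else 0.

(* delta^k, summed over all p *)
Definition delta (k : nat) : chains -> chains :=
  fglift (fun f => delta_symbol k f (eI (face_index f))).

Lemma symbolN f (eps : ext N) : symbol f (- eps) = - symbol f eps.
Proof. by rewrite /symbol ffunE mulrNz. Qed.

Lemma delta_symbolN k f (eps : ext N) :
  delta_symbol k f (- eps) = - delta_symbol k f eps.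
Proof.
rewrite /delta_symbol; case: ifP => _; last by rewrite oppr0.
have E (g : open_faces X (codim f - k)) :
    symbol (Face g) (contract (face_gap (Face g) f) (- eps)) =
    - symbol (Face g) (contract (face_gap (Face g) f) eps).
  by rewrite contractN symbolN.
under eq_fsbigr => g _ do rewrite E.
exact: fsumrN.
Qed.

Lemma delta_is_zmod_morphism k : zmod_morphism (delta k).
Proof. exact: lift_is_additive. Qed.

HB.instance Definition _ k := GRing.isZmodMorphism.Build chains chains (delta k)
  (delta_is_zmod_morphism k).

Lemma deltaE k f (eps : ext N) : orientation f eps ->
  delta k (symbol f eps) = delta_symbol k f eps.
Proof.
have H : delta k << f >> = delta_symbol k f (eI (face_index f)).
  by rewrite /delta liftU scale1r.
have H1 : symbol f (eI (face_index f)) = << f >>.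
  by rewrite /symbol ffunE eqxx.
case=> ->; first by rewrite H1.
by rewrite symbolN H1 delta_symbolN raddfN /= H.
Qed.

(* delta^k = 0 for k > nhyp X, since codimensions are at most nhyp X. *)
Definition delta_pcn (c : chains) : chains :=
  \sum_(k < N.+1) delta (2 * k + 1) c.

Lemma delta_pcn_is_zmod_morphism : zmod_morphism delta_pcn.
Proof.
by move=> c c'; rewrite /delta_pcn -sumrB; apply: eq_bigr => k _; rewrite raddfB.
Qed.

HB.instance Definition _ := GRing.isZmodMorphism.Build chains chains delta_pcn
  delta_pcn_is_zmod_morphism.

(* The sum of the C_p(X) with p of the given parity; b = true means odd. *)
Definition chains_parity (b : bool) : {pred chains} :=
  [pred c : chains | all (fun f : face => odd (codim f) == b) (dom c)].

Lemma chains_parity_zmod_closed b : zmod_closed (chains_parity b).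
Proof.
split=> [|c c' /allP Hc /allP Hc']; first by rewrite inE dom0.
apply/allP => f /domB; rewrite mem_cat => /orP[/Hc|/Hc'] //.
Qed.

HB.instance Definition _ b := GRing.isZmodClosed.Build chains (chains_parity b)
  (chains_parity_zmod_closed b).

End Chains.

Section Homology.
Context {C : zmodType} (gr : bool -> zmodClosed C).

Section OneDifferential.
Variables (d : {additive C -> C}) (b : bool).

Definition cycles : {pred C} := [pred c : C | (c \in gr b) && (d c == 0)].

Lemma cycles_zmod_closed : zmod_closed cycles.
Proof.
split=> [|c c']; first by rewrite inE rpred0 raddf0 eqxx.
move=> /andP[Hc /eqP dc] /andP[Hc' /eqP dc'].
by rewrite inE rpredB // raddfB /= dc dc' subrr eqxx.
Qed.

HB.instance Definition _ := GRing.isZmodClosed.Build C cycles cycles_zmod_closed.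

Definition boundaries : {pred C} :=
  [pred c : C | `[< exists2 y, y \in gr (~~ b) & c = d y >]].

Lemma boundaries_zmod_closed : zmod_closed boundaries.
Proof.
split=> [|c c' /asboolP[y Hy ->] /asboolP[y' Hy' ->]].
  by apply/asboolP; exists 0; [exact: rpred0 | rewrite raddf0].
by apply/asboolP; exists (y - y'); [exact: rpredB | rewrite raddfB].
Qed.

Record cycle := Cycle { cycle_val :> C; cycleP : cycle_val \in cycles }.

HB.instance Definition _ := [isSub for cycle_val].
HB.instance Definition _ := [Choice of cycle by <:].
HB.instance Definition _ := [SubChoice_isSubZmodule of cycle by <:].

(* When d \o d = 0 on gr these are all the boundaries. *)
Definition boundary_cycles : {pred cycle} :=
  [pred z : cycle | cycle_val z \in boundaries].

Lemma boundary_cycles_zmod_closed : zmod_closed boundary_cycles.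
Proof.
have [H0 HB] := boundaries_zmod_closed.
split=> [|z z' Hz Hz'].
  change (cycle_val 0 \in boundaries).
  have -> : cycle_val 0 = 0 by exact: (raddf0 (val : cycle -> C)).
  exact: H0.
change (cycle_val (z - z') \in boundaries).
have -> : cycle_val (z - z') = cycle_val z - cycle_val z'.
  exact: (raddfB (val : cycle -> C)).
exact: HB.
Qed.

HB.instance Definition _ := GRing.isZmodClosed.Build cycle boundary_cycles
  boundary_cycles_zmod_closed.

Definition homology : zmodType := Quotient.quot boundary_cycles.

Definition homology_class (z : cycle) : homology :=
  \pi_(Quotient.quot boundary_cycles) z.

End OneDifferential.

Definition identity_induces_isomorphism (d d' : {additive C -> C}) : Prop :=
  forall b : bool,
  [/\ {subset cycles d b <= cycles d' b},
      {subset boundaries d b <= boundaries d' b}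
    & exists2 phi : {additive homology d b -> homology d' b},
        bijective phi
      & forall (z : cycle d b) (z' : cycle d' b), z = z' :> C ->
          phi (homology_class z) = homology_class z'].

End Homology.

(* Main.v *)
From HB Require Import structures.
Require Import Defs.
From mathcomp Require Import all_boot all_order all_algebra.
From mathcomp Require Import all_classical all_reals all_analysis.
From mathcomp Require Import freeg.
From mathcomp Require Import ring lra.

(* For a face f and a set J of indices of defining functions vanishing on f
   there is exactly one face f_J whose index set is that of f minus J and whose
   closure contains f.  This is local: by the inverse function theorem the
   defining functions vanishing at a point become linear in suitable
   coordinates, so that each stratum meets small neighbourhoods of the point in
   a convex, hence connected, set.

   Consequently delta^k (f (x) e) is the sum of f_J (x) (e_J contracted with e)
   over the J with k elements.  Contractions anticommute, and for |L| odd
     \sum_(i in L) e_i _| (e_(L \ i) _| e) = e_L _| e,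
   because the signs alternate and cancel up to one; so
   delta^(2k+1) = delta^1 delta^(2k) = delta^(2k) delta^1.  Hence delta^pcn is
   delta^1 composed, on either side, with U = \sum_k delta^(2k).  U preserves
   parity and is unipotent, as U - 1 lowers the codimension; so both
   differentials have the same cycles and the same boundaries. *)

Set Implicit Arguments.
Unset Strict Implicit.
Unset Printing Implicit Defensive.

Import Order.TTheory GRing.Theory Num.Theory.
Import numFieldNormedType.Exports.

Local Open Scope ring_scope.

(** * Local normal form of the defining functions *)

Section Euclidean.
Local Open Scope classical_set_scope.
Local Open Scope ring_scope.
Context {R : realType}.

Lemma connected_joined (T : topologicalType) (A : set T) :
  (forall x y, A x -> A y ->
     exists C : set T, [/\ C x, C y, C `<=` A & connected C]) ->
  connected A.
Proof.
move=> joinA; have [->|/set0P[x Ax]] := eqVneq A set0; first exact: connected0.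
suff -> : A = connected_component A x by exact: component_connected.
apply/seteqP; split=> [y Ay|]; last exact: connected_component_sub.
by have [C [Cx Cy CA Cc]] := joinA x y Ax Ay; exists C.
Qed.

Lemma convex_connected (V : normedModType R) (A : set V) :
  (forall x y (t : R), A x -> A y -> 0 <= t <= 1 -> A (x + t *: (y - x))) ->
  connected A.
Proof.
move=> convA; apply: connected_joined => x y Ax Ay.
exists ((fun t : R => x + t *: (y - x)) @` `[0, 1]%classic); split.
- by exists 0; rewrite ?scale0r ?addr0 //= in_itv /= lexx ler01.
- by exists 1; rewrite ?scale1r ?subrKC //= in_itv /= lexx ler01.
- by move=> z [t t01 <-]; move: t01; rewrite /= in_itv /= => t01; exact: convA.
- apply: connected_continuous_connected; first exact: segment_connected.
  apply: continuous_subspaceT.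
  by move=> t; apply: cvgD; [exact: cvg_cst|apply: cvgZr_tmp; exact: cvg_id].
Qed.

Lemma coord_le_norm n (x : 'rV[R]_n) i : `|x 0 i| <= `|x|.
Proof.
rewrite [`|x|]mx_normrE.
exact: (le_bigmax_cond _ (fun ij : 'I_1 * 'I_n => `|x ij.1 ij.2|)
  (j := (0, i))).
Qed.

Lemma norm_le_coord n (x : 'rV[R]_n) (c : R) :
  0 <= c -> (forall i, `|x 0 i| <= c) -> `|x| <= c.
Proof.
move=> c0 xc; rewrite [`|x|]mx_normrE; apply/bigmax_leP; split=> // -[i j] _.
by rewrite ord1.
Qed.

End Euclidean.

(** * Mean value estimates from bounds on partial derivatives *)

Section MeanValue.
Local Open Scope classical_set_scope.
Local Open Scope ring_scope.
Context {R : realType}.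

(** Both difference quotients are the same function of [t], so one-variable calculus applies along a
    line. *)
Lemma is_derive_line (V : normedModType R) (h : V -> R) (z e : V) (s : R) :
  derivable h (s *: e + z) e ->
  is_derive s (1 : R) (fun t : R => h (t *: e + z)) ('D_e h (s *: e + z)).
Proof.
have E : (fun t : R => t^-1 *: (((fun t => h (t *: e + z)) \o shift s) (t *: 1)
             - h (s *: e + z))) =
    (fun t => t^-1 *: ((h \o shift (s *: e + z)) (t *: e) - h (s *: e + z))).
  by apply/funext => t /=; rewrite [t *: 1]mulr1 scalerDl addrA.
by move=> dh; split; rewrite /derivable /derive E.
Qed.

Lemma directional_mean_value (V : normedModType R) (h : V -> R) (z e : V)
    (c t : R) : 0 <= t ->
  (forall s, 0 <= s <= t ->
     derivable h (s *: e + z) e /\ `|'D_e h (s *: e + z)| <= c) ->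
  `|h (t *: e + z) - h z| <= c * t.
Proof.
move=> t0 dh; pose f (s : R) := h (s *: e + z).
have df (s : R) : s \in `[0, t] -> is_derive s 1 f ('D_e h (s *: e + z)).
  by rewrite in_itv /= => /dh[dhs _]; exact: is_derive_line.
have cf : {within `[0, t], continuous f}.
  by apply: derivable_within_continuous => s /df.
have [s + Ef] := MVT_segment t0 (fun s st => df s (subset_itv_oo_cc st)) cf.
rewrite in_itv /= => /dh[_ dhs].
have -> : h (t *: e + z) - h z = f t - f 0 by rewrite /f scale0r add0r.
by rewrite Ef subr0 normrM (ger0_norm t0) ler_wpM2r.
Qed.

(** The norm is the sup norm, so a ball is a box, and the segment joining two of its points that
    differ in one coordinate stays inside it. *)
Lemma coordinate_mean_value n (h : 'rV[R]_n -> R) (x : 'rV[R]_n) (r c : R)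
    (y z : 'rV[R]_n) (k : 'I_n) :
  (forall w, `|x - w| < r -> forall i, derivable h w (dirvec i) /\
     `|'D_(dirvec i) h w| <= c) ->
  `|x - y| < r -> `|x - z| < r -> (forall i, i != k -> y 0 i = z 0 i) ->
  `|h y - h z| <= c * `|y - z|.
Proof.
move=> dh; wlog yz : y z / z 0 k <= y 0 k.
  move=> W yr zr E; have [|/ltW] := leP (z 0 k) (y 0 k); first by move/W; exact.
  by move=> /W W'; rewrite distrC [`|y - z|]distrC W' // => i /E ->.
move=> yr zr E.
have c0 : 0 <= c by have [_] := dh y yr k; apply: le_trans.
have yE : y = (y 0 k - z 0 k) *: dirvec k + z.
  apply/rowP => i; rewrite !mxE eqxx /=; have [->|/E ->] := eqVneq i k.
    by rewrite mulr1 subrK.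
  by rewrite mulr0 add0r.
rewrite {1}yE.
have yzk : y 0 k - z 0 k <= `|y - z|.
  by have := coord_le_norm (y - z) k; rewrite !mxE ger0_norm // subr_ge0.
have yz0 : 0 <= y 0 k - z 0 k by rewrite subr_ge0.
apply: le_trans (ler_wpM2l c0 yzk); apply: (directional_mean_value yz0).
move=> s /andP[s0 st]; suff /dh/(_ k) : `|x - (s *: dirvec k + z)| < r by [].
have r0 : 0 < r by apply: le_lt_trans yr.
(* Every coordinate of a point of the segment is at most as far from that of [x] as one of the two
   endpoints allows. *)
apply: (@le_lt_trans _ _ (Num.max `|x - y| `|x - z|)); last first.
  by rewrite gt_max yr.
apply: norm_le_coord; first by rewrite le_max normr_ge0.
move=> i; have := coord_le_norm (x - y) i; have := coord_le_norm (x - z) i.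
rewrite !mxE eqxx /= le_max; have [->|/E ->] := eqVneq i k; last first.
  by rewrite mulr0 add0r => -> _; rewrite orbT.
rewrite mulr1 => zk yk; apply/orP.
(* Past [x 0 k] the endpoint [y] is farther from [x] than the point is; before it, [z] is. *)
have [xk|xk] := leP (x 0 k) (s + z 0 k); [left; apply: le_trans yk|
  right; apply: le_trans zk].
- rewrite [leRHS]ler0_norm ?ler0_norm; lra.
- rewrite [leRHS]ger0_norm ?ger0_norm; lra.
Qed.

(** The coordinates are changed one at a time on the way from [z] to [y], whence the factor [n]; the
    intermediate points stay in the box. *)
Lemma ball_mean_value n (h : 'rV[R]_n -> R) (x : 'rV[R]_n) (r c : R)
    (y z : 'rV[R]_n) :
  (forall w, `|x - w| < r -> forall i, derivable h w (dirvec i) /\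
     `|'D_(dirvec i) h w| <= c) ->
  `|x - y| < r -> `|x - z| < r -> `|h y - h z| <= (c *+ n) * `|y - z|.
Proof.
move=> dh yr zr.
have r0 : 0 < r by apply: le_lt_trans yr.
pose w (k : nat) : 'rV[R]_n := \row_i if (i < k)%N then y 0 i else z 0 i.
have w0 : w 0%N = z by apply/rowP => i; rewrite mxE.
have wn : w n = y by apply/rowP => i; rewrite mxE ltn_ord.
have wr k : `|x - w k| < r.
  apply: (@le_lt_trans _ _ (Num.max `|x - y| `|x - z|)); last first.
    by rewrite gt_max yr.
  apply: norm_le_coord; first by rewrite le_max normr_ge0.
  move=> i; have := coord_le_norm (x - y) i; have := coord_le_norm (x - z) i.
  by rewrite !mxE le_max => hz hy; case: ifP => _; rewrite ?hz ?hy ?orbT.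
have -> : h y - h z = \sum_(0 <= k < n) (h (w k.+1) - h (w k)).
  by rewrite telescope_sumr // wn w0.
rewrite big_mkord; apply: le_trans (ler_norm_sum _ _ _) _.
have -> : (c *+ n) * `|y - z| = \sum_(k < n) c * `|y - z|.
  by rewrite sumr_const card_ord mulrnAl.
apply: ler_sum => k _.
have c0 : 0 <= c by have [_] := dh y yr k; apply: le_trans.
have wk i : i != k -> w k.+1 0 i = w k 0 i.
  by move=> ik; rewrite !mxE ltnS leq_eqVlt val_eqE (negPf ik).
apply: le_trans (coordinate_mean_value dh (wr k.+1) (wr k) wk) _.
rewrite ler_wpM2l //; apply: norm_le_coord => // i.
have := coord_le_norm (y - z) i; rewrite !mxE.
by case: ifP => _; case: ifP => _ // h1;
  rewrite ?subrr ?normr0 ?normr_ge0 // distrC.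
Qed.

End MeanValue.

(** * Local inversion of a map close to the identity *)

Section InverseFunction.
Local Open Scope classical_set_scope.
Local Open Scope ring_scope.
Context {R : realType}.

(** Solving [f y = w] amounts to finding a fixed point of [y |-> w - (f y - y)], a contraction with
    constant 1/2. *)
Lemma near_identity_inverse (V : completeNormedModType R) (f : V -> V) (x : V)
    (r : R) : 0 < r ->
  (forall y z, `|x - y| < r -> `|x - z| < r ->
     `|(f y - y) - (f z - z)| <= 2^-1 * `|y - z|) ->
  exists g : V -> V,
    [/\ forall w, `|f x - w| < r / 4 -> `|x - g w| < r /\ f (g w) = w,
        forall y, `|x - y| < r -> `|f x - f y| < r / 4 -> g (f y) = y
      & {within [set w | `|f x - w| < r / 4], continuous g}].
Proof.
move=> r0 fr.
have x0 : `|x - x| < r by rewrite subrr normr0.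
(* From [|y - z| <= |f y - f z| + |y - z| / 2]. This gives injectivity, and continuity of the
   inverse. *)
have expand y z : `|x - y| < r -> `|x - z| < r -> `|y - z| <= 2 * `|f y - f z|.
  move=> yr zr; have := fr y z yr zr.
  have := ler_normB (f y - f z) ((f y - y) - (f z - z)).
  have -> : f y - f z - ((f y - y) - (f z - z)) = y - z.
    by rewrite !opprB -(addrA (f z)) subrKA addrCA subrKC addrC.
  set a := `|y - z|; set b := `|f y - f z|; set c := `|_|.
  clearbody a b c; lra.
have surj w : `|f x - w| < r / 4 -> exists y, `|x - y| < r /\ f y = w.
  move=> wr.
  (* A closed ball inside the given open one; the contraction preserves it because
     [r / 4 + (r / 2) / 2 = r / 2]. *)
  pose U := [set y | `|x - y| <= r / 2].
  have Ur y : U y -> `|x - y| < r.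
    by move=> /le_lt_trans; apply; rewrite ltr_pdivrMr // ltr_pMr // ltr1n.
  have TU y : U y -> U (w - (f y - y)).
    move=> Uy; rewrite /U /=.
    have -> : x - (w - (f y - y)) = (f x - w) - ((f x - x) - (f y - y)).
      by rewrite !opprB [RHS]addrCA [_ - w + _]addrC subrKA addrCA.
    apply: le_trans (ler_normB _ _) _.
    have := fr x y x0 (Ur y Uy); move: Uy wr; rewrite /U /=.
    set a := `|x - y|; set b := `|f x - w|; set c := `|_|.
    clearbody a b c; lra.
  have ctr : is_contraction (mkfun_fun TU).
    exists (2^-1)%:nng; split=> [/=|[y z] /= [Uy Uz]]; first lra.
    have -> : w - (f y - y) - (w - (f z - z)) = - ((f y - y) - (f z - z)).
      by rewrite [- (w - _)]opprB [RHS]opprB addrC subrKA.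
    by rewrite normrN; exact: fr (Ur y Uy) (Ur z Uz).
  have clU : closed U by exact: closed_closed_ball_.
  have U0 : U !=set0 by exists x; rewrite /U /= subrr normr0 divr_ge0 // ltW.
  have [y Uy yT] := banach_fixed_point ctr clU U0.
  exists y; split; first exact: Ur.
  move/(congr1 (+%R (f y - y))): yT; rewrite subrKC.
  by rewrite subrK.
have [g gP] : exists g : V -> V, forall w, `|f x - w| < r / 4 ->
    `|x - g w| < r /\ f (g w) = w.
  have [w|g gP] := @choice _ _
      (fun w y => `|f x - w| < r / 4 -> `|x - y| < r /\ f y = w).
    have [/surj[y ?]|] := pselect (`|f x - w| < r / 4); first by exists y.
    by exists 0.
  by exists g.
exists g; split=> //.
- move=> y yr fyr; have [gr fg] := gP _ fyr.
  apply/eqP; rewrite -subr_eq0 -normr_le0.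
  by apply: le_trans (expand _ _ gr yr) _; rewrite fg subrr normr0 mulr0.
- apply/subspace_continuousP => w wr; apply/cvgrPdist_lt => e e0.
  have [gw fgw] := gP _ wr.
  near=> z.
  have zr : `|f x - z| < r / 4 by near: z; exact: withinT.
  have [gz fgz] := gP _ zr.
  apply: le_lt_trans (expand _ _ gw gz) _; rewrite fgw fgz.
  rewrite -ltr_pdivlMl //; near: z; apply: cvg_within.
  apply: (@cvgr_dist_lt _ _ _ (nbhs w) _ id w); first exact: cvg_id.
  by rewrite mulr_gt0.
Unshelve. all: by end_near. Qed.

End InverseFunction.

(** Joins completeness to the normed structure, so that [near_identity_inverse] applies to row
    vectors. *)
HB.instance Definition _ (R : realType) m n := Complete.on 'M[R]_(m, n).

(** * Coordinates in which independent functions become linear *)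

Section Straightening.
Local Open Scope classical_set_scope.
Local Open Scope ring_scope.
Context {R : realType}.

Lemma is_derive_linear (V : normedModType R) (L : V -> R) (w v : V) :
  (forall a y z, L (a *: y + z) = a * L y + L z) -> is_derive w v L (L v).
Proof.
move=> linL.
have E : (fun t : R => t^-1 *: ((L \o shift w) (t *: v) - L w)) @ 0^' --> L v.
  apply: (@cvg_near_cst R^o); near=> t.
  have t0 : t != 0 by near: t; exact: nbhs_dnbhs_neq.
  by rewrite /= linL addrK [LHS]mulKf.
split; first by apply/cvg_ex; exists (L v).
exact: cvg_lim E.
Unshelve. all: by end_near. Qed.

Section Straight.
Variables (m n : nat) (r : 'I_m -> 'rV[R]_n -> R) (x : 'rV[R]_n).
Variable U : set 'rV[R]_n.
Hypotheses (Uo : open U) (Ux : U x) (r1 : forall i, Ck_on 1 U (r i)).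
Let J : 'M[R]_(m, n) := \matrix_(i, k) 'D_(dirvec k) (r i) x.
Variable B : 'M[R]_(n, m).
Hypothesis JB : J *m B = 1%:M.

Let rr (y : 'rV[R]_n) : 'rV[R]_m := \row_i r i y.
(* Since J B = 1, the derivative of this map at x is the identity, and in the
   new coordinates the functions r i are linear. *)
Definition straighten (y : 'rV[R]_n) : 'rV[R]_n :=
  y + (rr y - y *m J^T) *m B^T.

(** As [B^T *m J^T] is the transpose of [J *m B = 1], the two linear terms cancel. *)
Lemma straightenE y i : (straighten y *m J^T) 0 i = r i y.
Proof.
rewrite /straighten mulmxDl -mulmxA -trmx_mul JB trmx1 mulmx1 subrKC.
by rewrite mxE.
Qed.

(** The difference [straighten y - y] is [r - L] followed by [B^T], with [L] the differential of [r]
    at [x]. The partial derivatives of [r - L] vanish at [x], hence are small nearby by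
    continuity. *)
Lemma straighten_near_identity : \forall rho \near (0 : R)^'+, forall y z,
  `|x - y| < rho -> `|x - z| < rho ->
  `|(straighten y - y) - (straighten z - z)| <= 2^-1 * `|y - z|.
Proof.
(* [C] bounds the effect of [B], and [e] will bound the partial derivatives of [r - L]; it is chosen
   so that [e * n * C <= 1 / 2], the [+ 1] keeping the denominator positive. *)
pose C : R := \sum_i \sum_k `|B k i|.
have C0 : 0 <= C by do 2 apply: sumr_ge0 => ? _.
pose e : R := (2 * (C *+ n + 1))^-1.
have e0 : 0 < e by rewrite invr_gt0 mulr_gt0 // ltr_wpDl // mulrn_wge0.
pose h i (y : 'rV[R]_n) : R := r i y - (y *m J^T) 0 i.
have Dnear i k :
    \forall w \near x, `|'D_(dirvec k) (r i) x - 'D_(dirvec k) (r i) w| < e.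
  by have [_ /(_ k)[_ [/(_ x Ux) /cvgrPdist_lt c _]]] := r1 i; exact: c.
have : \forall w \near x, U w /\ forall i k,
    `|'D_(dirvec k) (r i) x - 'D_(dirvec k) (r i) w| < e.
  apply: filterI; first exact: open_nbhs_nbhs.
  exact: (filter_forall _ (fun i => filter_forall _ (Dnear i))).
move=> /nbhs_ballP [rho /= rho0 near_x].
near=> s => y z ys zs.
have srho : s <= rho by near: s; exact: nbhs_right_le.
have dh w : `|x - w| < s -> forall i k, derivable (h i) w (dirvec k) /\
    `|'D_(dirvec k) (h i) w| <= e.
  move=> ws i k.
  have [Uw] : U w /\ forall i k,
      `|'D_(dirvec k) (r i) x - 'D_(dirvec k) (r i) w| < e.
    by apply: near_x; rewrite -ball_normE /=; apply: lt_le_trans srho.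
  move=> /(_ i k) Dr.
  have [_ /(_ k)[/(_ w Uw) dr _]] := r1 i.
  have dL : is_derive w (dirvec k) (fun y : 'rV[R]_n => (y *m J^T) 0 i)
      ((dirvec k *m J^T) 0 i).
    by apply: is_derive_linear => a y' z'; rewrite mulmxDl -scalemxAl !mxE.
  have /derivableP dr' := dr.
  have dh := is_deriveB dr' dL.
  split; first exact: ex_derive.
  rewrite [X in `|X|](derive_val (is_derive := dh)).
  rewrite -rowE !mxE.
  by rewrite distrC ltW.
have hyz i : `|h i y - h i z| <= e *+ n * `|y - z|.
  by apply: (ball_mean_value (x := x) (r := s)) => // w /dh; exact.
apply: norm_le_coord; first by rewrite mulr_ge0.
move=> k; rewrite /straighten !(addrC (_ : 'rV[R]_n) (_ *m _)) !addrK.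
rewrite -mulmxBl mxE.
apply: le_trans (ler_norm_sum _ _ _) _.
have Ck : \sum_i `|B k i| <= C.
  apply: ler_sum => i _; rewrite (bigD1 k) //= lerDl.
  by apply: sumr_ge0.
apply: le_trans (_ : \sum_i e *+ n * `|y - z| * `|B k i| <= _).
  apply: ler_sum => i _; rewrite normrM !mxE.
  apply: ler_wpM2r => //; have := hyz i; rewrite /h !mxE opprB; exact.
rewrite -mulr_sumr mulrAC; apply: ler_wpM2r => //.
apply: le_trans (_ : e *+ n * C <= _).
  by rewrite ler_wpM2l // mulrn_wge0 // ltW.
rewrite mulrnAl -mulrnAr ler_pdivrMl ?mulr_gt0 ?ltr_wpDl ?mulrn_wge0 //.
by rewrite mulrC mulrA mulVf // mul1r lerDl.
Unshelve. all: by end_near. Qed.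

(** In the new coordinates [Q] is given by the linear conditions [P], so its trace on a ball is
    convex; the continuous local inverse carries this trace to a connected set. *)
Lemma straight_quadrant (W : set 'rV[R]_n) (K : pred 'I_m) :
  (forall i, r i x = 0) -> nbhs x W ->
  let Q := [set y | forall i, if K i then r i y = 0 else 0 < r i y] in
  exists S : set 'rV[R]_n,
    [/\ nbhs x S, S `<=` W, S `&` Q !=set0 & connected (S `&` Q)].
Proof.
move=> rx Wx Q.
pose P := [set w : 'rV[R]_n | forall i,
  if K i then (w *m J^T) 0 i = 0 else 0 < (w *m J^T) 0 i].
have PQ y : P (straighten y) = Q y.
  by apply/propext; split=> + i => /(_ i); rewrite straightenE.
have [s [s0 sW lip]] : exists s : R, [/\ 0 < s, ball x s `<=` W &
    forall y z, `|x - y| < s -> `|x - z| < s ->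
    `|(straighten y - y) - (straighten z - z)| <= 2^-1 * `|y - z|].
  have /nbhs_ballP[rho /= rho0 rhoW] := Wx.
  near (0 : R)^'+ => s; exists s; split.
  - by near: s; exact: nbhs_right_gt.
  - apply: subset_trans rhoW; apply: le_ball.
    by near: s; exact: nbhs_right_le.
  - by near: s; exact: straighten_near_identity.
have x0 : `|x - x| < s by rewrite subrr normr0.
have [g [gP gK gc]] := near_identity_inverse s0 lip.
pose D := [set w | `|straighten x - w| < s / 4].
exists [set y | `|x - y| < s /\ `|straighten x - straighten y| < s / 4].
have SQ : [set y | `|x - y| < s /\ `|straighten x - straighten y| < s / 4] `&` Q
    = g @` (D `&` P).
  apply/seteqP; split=> y.
    move=> [[ys fys] Qy]; exists (straighten y); last exact: gK.
    by split=> //; rewrite PQ.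
  move=> [w [Dw Pw] <-]; have [gs fg] := gP _ Dw.
  by split; [split; rewrite ?fg|rewrite -PQ fg].
split.
(* Here [straighten] stretches distances from [x] by at most 3/2, and [3 / 2 * (s / 8) < s / 4]. *)
- have sball : ball x (s / 8) `<=`
      [set y | `|x - y| < s /\ `|straighten x - straighten y| < s / 4].
    move=> y; rewrite -ball_normE /= => ys8.
    have ys : `|x - y| < s by lra.
    split=> //; have := lip x y x0 ys.
    have := ler_normD (straighten x - straighten y - (x - y)) (x - y).
    rewrite subrK; have -> : straighten x - straighten y - (x - y) =
        (straighten x - x) - (straighten y - y).
      by rewrite !opprB addrACA [RHS]addrACA (addrC (- x)).
    move: ys8; set a := `|x - y|; set b := `|_ - straighten y|; set c := `|_|.
    clearbody a b c; lra.
  by apply: (filterS sball); apply: nbhsx_ballx; rewrite divr_gt0.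
- by move=> y [ys _]; apply: sW; rewrite -ball_normE.
(* Moving from [straighten x] by [t] times [c *m B^T] changes the i-th linear form from 0 to
   [t * c_i]: it stays 0 for i in [K] and becomes positive otherwise. The move is shorter than
   [s / 8]. *)
- pose c : 'rV[R]_m := \row_i if K i then 0 else 1.
  pose t := s / 8 / (1 + `|c *m B^T|).
  have t0 : 0 < t by rewrite !divr_gt0 // ltr_wpDr.
  rewrite SQ; exists (g (straighten x + t *: (c *m B^T))).
  exists (straighten x + t *: (c *m B^T)) => //; split.
    rewrite /D /= opprD addNKr normrN normrZ gtr0_norm // /t mulrAC.
    rewrite ltr_pdivrMr ?ltr_wpDr //.
    have : 0 <= `|c *m B^T| by []. set a := `|_|; clearbody a; nra.
  move=> i; rewrite mulmxDl -scalemxAl -mulmxA -trmx_mul JB trmx1 mulmx1.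
  rewrite mxE straightenE rx add0r mxE [X in _ * X]mxE.
  by case: (K i); rewrite ?mulr0 ?mulr1.
- rewrite SQ; apply: connected_continuous_connected; last first.
    by apply: continuous_subspaceW gc => w [].
  apply: convex_connected => w w' t [Dw Pw] [Dw' Pw'] /andP[t0 t1]; split.
    rewrite /D /=.
    have -> : straighten x - (w + t *: (w' - w)) =
        (1 - t) *: (straighten x - w) + t *: (straighten x - w').
      by apply/rowP => j; rewrite !mxE; ring.
    apply: le_lt_trans (ler_normD _ _) _.
    rewrite !normrZ (ger0_norm t0) ger0_norm ?subr_ge0 //.
    move: Dw Dw'; rewrite /D /=.
    set a := `|_ - w|; set b := `|_ - w'|; clearbody a b => Dw Dw'.
    have [->|tn0] := eqVneq t 0; first by rewrite mul0r subr0 mul1r addr0.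
    have tp : 0 < t by rewrite lt_def tn0.
    nra.
  move=> i; have := Pw i; have := Pw' i; rewrite mulmxDl -scalemxAl mulmxBl.
  set a := w *m _; set b := w' *m _; clearbody a b; rewrite !mxE.
  case: (K i) => [-> ->|bi ai]; first by rewrite subrr mulr0 addr0.
  have [->|tn0] := eqVneq t 0; first by rewrite mul0r addr0.
  have tp : 0 < t by rewrite lt_def tn0.
  nra.
Unshelve. all: by end_near. Qed.

End Straight.
End Straightening.

(** * Faces *)

(** Independent rows give full row rank. This turns the independence of the differentials into the
    matrix [B] used for straightening. *)
Lemma free_right_inverse (F : fieldType) (T : finType) (n : nat)
    (D : T -> 'rV[F]_n) (I : {set T}) :
  free [seq D j | j <- enum I] ->
  exists B : 'M[F]_(n, #|I|), (\matrix_(i < #|I|) D (enum_val i)) *m B = 1%:M.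
Proof.
move=> freeD; apply/row_freeP/inj_row_free => v vD0.
have sz : size [seq D j | j <- enum I] == #|I| by rewrite size_map cardE.
have := @freeP _ _ _ (Tuple sz) freeD (fun i => v 0 i).
move=> vP; apply/rowP => i; rewrite [RHS]mxE; apply: vP.
rewrite -[RHS]vD0 mulmx_sum_row; apply: eq_bigr => j _.
rewrite rowK /= (nth_map (enum_val j)) -?cardE //; congr (_ *: D _).
by rewrite [RHS](enum_val_nth (enum_val j)).
Qed.

Section LocallyConstant.
Local Open Scope classical_set_scope.
Local Open Scope ring_scope.

(** The level set of [f] through [x] and its complement in [A] are both relatively open. *)
Lemma locally_constant_connected (T : topologicalType) (Y : Type) (A : set T)
    (f : T -> Y) :
  connected A -> (forall x, A x -> (\forall y \near x, A y -> f y = f x)) ->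
  forall x y, A x -> A y -> f x = f y.
Proof.
move=> connA locA x y Ax Ay.
have : A `&` [set z | f z = f x] = A.
  apply: connA; first by exists x.
  - exists [set z | A z -> f z = f x]°; first exact: open_interior.
    apply/seteqP; split=> z [Az fz]; split=> //.
      by apply: filterS (locA z Az) => w /[apply] ->.
    by have := nbhs_singleton fz; exact.
  - exists (~` [set z | A z -> f z <> f x]°).
      exact/open_closedC/open_interior.
    apply/seteqP; split=> z [Az fz]; split=> //.
      by move=> /nbhs_singleton /(_ Az); exact.
    apply: contrapT => fzx; apply: fz.
    by apply: filterS (locA z Az) => w /[apply] ->.
by move=> /seteqP[_ /(_ y Ay)[_ <-]].
Qed.

End LocallyConstant.

(** * The local structure of a manifold with corners *)

Section Corners.
Local Open Scope classical_set_scope.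
Local Open Scope ring_scope.
Context {R : realType} {n : nat} (X : manifoldWithCorners R n).
Local Notation N := (nhyp X).

Definition zero_index (x : ambient X) : {set 'I_N} :=
  [set i | rho i x == 0]%SET.

(** Prescribes which defining functions vanish, where [stratum] prescribes only how many. *)
Definition index_locus (K : {set 'I_N}) : set (ambient X) :=
  [set x | points X x /\ zero_index x = K].

(** A chart transports [straight_quadrant]. The functions positive at [x] stay positive nearby, so
    close to [x] the locus depends only on the functions vanishing at [x], which are independent. *)
Lemma corner_local (x : ambient X) (W : set (ambient X)) (K : {set 'I_N}) :
  points X x -> K \subset zero_index x -> nbhs x W ->
  exists S, [/\ nbhs x S, S `<=` W,
    forall y, S y -> zero_index y \subset zero_index x,
    S `&` index_locus K !=set0 & connected (S `&` index_locus K)].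
Proof.
move=> Xx Kx Wx.
have [c cA cx] := atlas_cover x.
set x' := cmap c x; set U := cmap c @` cdom c.
have Uo : open U by exact: cimg_open.
have Ux' : U x' by exists x.
pose I := zero_index x.
have free_x : differentials_free (@rho R n X) I x.
  by apply: rho_independent => j; rewrite inE => /eqP.
have [B JB] := free_right_inverse (free_x c cA cx).
pose r (i : 'I_#|I|) (y : 'rV[R]_n) : R := rho (enum_val i) (cinv c y).
have r1 i : Ck_on 1 U (r i) by apply: (rho_smooth (enum_val i)).
have rx' i : r i x' = 0.
  by rewrite /r cmapK //; have := enum_valP i; rewrite inE => /eqP.
have {}JB : (\matrix_(i, k) 'D_(dirvec k) (r i) x') *m B = 1%:M.
  rewrite -[RHS]JB; congr (_ *m B); apply/matrixP => i k.
  by rewrite !mxE.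
pose W' : set 'rV[R]_n := U `&` [set y | W (cinv c y) /\
  forall j, j \notin I -> 0 < rho j (cinv c y)].
have Wx' : nbhs x' W'.
  apply: filterI; first exact: open_nbhs_nbhs.
  apply: filterI.
    have Wx' : nbhs (cinv c x') W by rewrite /x' cmapK.
    have /subspace_continuousP/(_ x' Ux' W Wx') nW := @cinv_continuous _ _ _ c.
    have {}nW : \forall y \near x', U y -> W (cinv c y) := nW.
    have nU : \forall y \near x', U y by exact: open_nbhs_nbhs.
    by apply: filterS2 nW nU => y; exact.
  suff pos j : \forall y \near x', j \notin I -> 0 < rho j (cinv c y).
    exact: (filter_forall _ pos).
  have [jI|jI] := boolP (j \in I); first by near=> y.
  have rj0 : 0 < rho j (cinv c x').
    rewrite /x' cmapK // lt_def Xx andbT.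
    by move: jI; rewrite inE.
  have [/(_ x' Ux') cj _] := rho_smooth j cA 0.
  by near=> y => _; near: y; exact: (cvgr_gt _ cj).
have [S [Sx' SW' [y [Sy Qy]] Sc]] := straight_quadrant Uo Ux' r1 JB
  (fun i => enum_val i \in K) rx' Wx'.
have QE z : S z -> index_locus K (cinv c z) =
    (forall i, if enum_val i \in K then r i z = 0 else 0 < r i z).
  move=> Sz; have [Uz [Wz Iz]] := SW' z Sz.
  apply/propext; split=> [[Xz zK] i|Qz].
    rewrite -zK inE; case: eqVneq => //; rewrite lt_def => -> /=; exact: Xz.
  have rI j : j \in I ->
      if j \in K then rho j (cinv c z) = 0 else 0 < rho j (cinv c z).
    by move=> Ij; have := Qz (enum_rank_in Ij j); rewrite /r enum_rankK_in.
  split.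
    move=> j; have [/rI|/Iz/ltW //] := boolP (j \in I).
    by case: ifP => _ => [->|/ltW].
  apply/setP => j; rewrite inE; have [/rI|jI] := boolP (j \in I).
    by case: ifP => _; [move=> ->; rewrite eqxx|move/gt_eqF].
  rewrite (gt_eqF (Iz j jI)); apply/esym/negbTE/(contra _ jI).
  exact: (fintype.subsetP Kx j).
have SE : (cinv c @` S) `&` index_locus K = cinv c @` (S `&` [set y | forall i,
    if enum_val i \in K then r i y = 0 else 0 < r i y]).
  apply/seteqP; split=> [_ [[z Sz <-] Kz]|_ [z [Sz Qz] <-]].
    by exists z => //; split=> //; rewrite /= -QE.
  by split; [exists z|rewrite QE].
exists (cinv c @` S); split.
- have /subspace_continuousP/(_ x cx)/(_ S Sx') nS := @cmap_continuous _ _ _ c.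
  have {}nS : \forall y \near x, cdom c y -> S (cmap c y) := nS.
  have nc : \forall y \near x, cdom c y.
    by apply: open_nbhs_nbhs; split=> //; exact: cdom_open.
  apply: filterS2 nS nc => z {}nS cz; exists (cmap c z); first exact: nS.
  exact: cmapK.
- by move=> _ [z /SW'[_ [Wz _]] <-].
- move=> _ [z /SW'[_ [_ Iz]] <-]; apply/fintype.subsetP => j.
  apply: contraTT => /Iz.
  by rewrite inE => /gt_eqF ->.
- by rewrite SE; exists (cinv c y); exists y.
- rewrite SE; apply: connected_continuous_connected => //.
  by apply: continuous_subspaceW (@cinv_continuous _ _ _ c) => z [/SW'[]].
Unshelve. all: by end_near. Qed.

End Corners.

(** * Index sets of faces, and the faces whose closure contains a given one *)

Section FaceLattice.
Local Open Scope classical_set_scope.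
Local Open Scope ring_scope.
Context {R : realType} {n : nat} {X : manifoldWithCorners R n}.
Local Notation N := (nhyp X).
Local Notation face := (face X).

Lemma stratumE p (x : ambient X) :
  stratum X p x = (points X x /\ #|zero_index x| = p).
Proof. by rewrite /stratum /= /zero_index cardsE. Qed.

Lemma index_locus_stratum (K : {set 'I_N}) :
  index_locus K `<=` stratum X #|K|.
Proof. by move=> x [Xx <-]; rewrite stratumE. Qed.

Lemma face_component (f : face) (x : ambient X) : face_set f x ->
  stratum X (codim f) x /\
  face_set f = connected_component (stratum X (codim f)) x.
Proof.
case: f => p A; rewrite /face_set /codim /= => Ax.
have [x0 _ AE] := set_valP A.
move: Ax; rewrite AE => Ax; split; first exact: connected_component_sub Ax.
exact: same_connected_component.
Qed.

Lemma face_nonempty (f : face) : face_set f !=set0.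
Proof.
case: f => p A; rewrite /face_set /=; have [x0 x0p AE] := set_valP A.
by exists x0; rewrite AE; exact: connected_component_refl.
Qed.

Lemma face_connected (f : face) : connected (face_set f).
Proof.
have [x /face_component[_ ->]] := face_nonempty f; exact: component_connected.
Qed.

Lemma face_eq (f g : face) (x : ambient X) :
  codim f = codim g -> face_set f x -> face_set g x -> f = g.
Proof.
move=> fg /face_component[_ fE] /face_component[_ gE].
move: fE gE; rewrite -fg; case: f g fg => p A [q B] /=.
rewrite /codim /face_set /= => pq; case: _ / pq B => B AE BE.
by congr existT; apply: val_inj; rewrite /= AE BE.
Qed.

Lemma component_face p (x : ambient X) : stratum X p x ->
  exists f : face, codim f = p /\ face_set f x.
Proof.
move=> px.
have Fx : connected_component (stratum X p) x \in open_faces X p.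
  by rewrite inE; exists x.
exists (Face (SigSub Fx)); split=> //; exact: connected_component_refl.
Qed.

(** Near a point the set of vanishing functions can only shrink, and on a face its cardinality is
    fixed; so it is locally constant on a connected set. *)
Lemma zero_index_face (f : face) (x y : ambient X) :
  face_set f x -> face_set f y -> zero_index x = zero_index y.
Proof.
apply: (locally_constant_connected (@face_connected f)).
move=> {x y} x fx; have [] := face_component fx; rewrite stratumE => -[Xx xf] _.
have [S [Sx _ Sle _ _]] := corner_local Xx (subxx _) filterT.
apply: filterS Sx => y /Sle le_yx fy; apply/eqP; rewrite eqEcard le_yx xf.
by have [] := face_component fy; rewrite stratumE => -[_ ->] _; exact: leqnn.
Qed.

Lemma face_indexE (f : face) (x : ambient X) :
  face_set f x -> face_index f = zero_index x.
Proof.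
move=> fx; apply/setP => i; rewrite !inE; apply/asboolP/eqP.
  by move=> /(_ x fx)[].
move=> rx y fy; split; first by have [[]] := face_component fy.
have := zero_index_face fx fy => /setP/(_ i); rewrite !inE rx eqxx => /esym.
by move=> /eqP.
Qed.

Lemma face_set_locus (f : face) : face_set f `<=` index_locus (face_index f).
Proof.
move=> x fx; split; last by rewrite (face_indexE fx).
by have [[]] := face_component fx.
Qed.

Lemma card_face_index (f : face) : #|face_index f| = codim f.
Proof.
have [x fx] := face_nonempty f; rewrite (face_indexE fx).
by have [] := face_component fx; rewrite stratumE => -[].
Qed.

Definition adherent (f g : face) : Prop := face_set f `<=` closure (face_set g).

Lemma adherent_refl (f : face) : adherent f f.
Proof. exact: subset_closure. Qed.

Lemma adherent_trans (f g h : face) :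
  adherent f g -> adherent g h -> adherent f h.
Proof.
move=> fg gh x /fg; have := closureS gh.
by have /closure_id <- := @closed_closure _ (face_set h); exact.
Qed.

(** Points of [g] occur arbitrarily near a point of [f], where no further function can vanish. *)
Lemma adherent_index (f g : face) :
  adherent f g -> face_index g \subset face_index f.
Proof.
move=> fg; have [x fx] := face_nonempty f; rewrite (face_indexE fx).
have [Xx _] := face_set_locus fx.
have [S [Sx _ Sle _ _]] := corner_local Xx (subxx _) filterT.
by have [y [gy /Sle]] := fg x fx S Sx; rewrite (face_indexE gy).
Qed.

(** The connected trace of the locus of [K] near [x] lies in a single face [g], and any face with
    index set [K] adherent to [x] meets this trace. The last clause makes the choice of [g] locally
    constant along [f]. *)
Lemma unique_germ (f : face) (x : ambient X) (K : {set 'I_N}) :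
  face_set f x -> K \subset face_index f ->
  exists g : face,
    [/\ face_index g = K,
        (forall h : face, face_index h = K -> closure (face_set h) x -> h = g)
      & \forall y \near x, face_set f y -> closure (face_set g) y].
Proof.
move=> fx; rewrite (face_indexE fx) => Kx; have [Xx _] := face_set_locus fx.
have [S [Sx _ _ [y [Sy Ky]] Sc]] := corner_local Xx Kx filterT.
have [g [gK gy]] := component_face (index_locus_stratum Ky).
have gS : S `&` index_locus K `<=` face_set g.
  have [_ ->] := face_component gy; rewrite gK.
  apply: connected_component_max => // z [_]; exact: index_locus_stratum.
exists g; split.
- by rewrite (face_indexE gy); case: Ky.
- move=> h hK hx; have [z [hz Sz]] := hx S Sx.
  apply: (@face_eq _ _ z) => //; last first.
    by apply: gS; split=> //; rewrite -hK; exact: face_set_locus.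
  by rewrite gK -card_face_index hK.
- have : \forall z \near x, S° z by exact: nbhs_interior.
  (* Applied at [z], [corner_local] gives points of the locus arbitrarily near [z] and inside [S],
     hence in [g]. *)
  apply: filterS => z Sz fz W Wz.
  have [Xz _] := face_set_locus fz.
  have Kz : K \subset zero_index z by rewrite -(zero_index_face fx fz).
  have [S' [_ S'W _ [w [S'w Kw]] _]] := corner_local Xz Kz (filterI Sz Wz).
  by have [Sw Ww] := S'W w S'w; exists w; split=> //; exact: gS.
Qed.

(** The faces chosen at the points of [f] by [unique_germ] agree, since the choice is locally
    constant and [f] is connected. *)
Lemma unique_face_above (f : face) (K : {set 'I_N}) : K \subset face_index f ->
  exists g : face, [/\ face_index g = K, adherent f g &
    forall h : face, face_index h = K -> adherent f h -> h = g].
Proof.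
move=> Kf.
pose germ (x : ambient X) (g : face) :=
  [/\ face_index g = K,
      (forall h : face, face_index h = K -> closure (face_set h) x -> h = g)
    & \forall y \near x, face_set f y -> closure (face_set g) y].
have [x|G GP] := @choice _ _ (fun x g => face_set f x -> germ x g).
  (* Off [f] nothing is asked of the choice, and [f] is a default value. *)
  have [fx|nfx] := pselect (face_set f x); last by exists f.
  by have [g gP] := unique_germ fx Kf; exists g.
have Gx x : face_set f x -> closure (face_set (G x)) x.
  by move=> fx; have [_ _ /nbhs_singleton] := GP x fx; exact.
have Gc x y : face_set f x -> face_set f y -> G x = G y.
  apply: (locally_constant_connected (@face_connected f)).
  move=> {x y} x fx; have [_ Gu] := GP x fx; apply: filterS => y yG fy.
  have [GyK Gyu _] := GP y fy; have [GxK _ _] := GP x fx.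
  by apply/esym; apply: Gyu => //; exact: yG.
have [x fx] := face_nonempty f; exists (G x); have [GK Gu _] := GP x fx.
split=> // [y fy|h hK fh]; first by rewrite (Gc x y fx fy); exact: Gx.
exact: Gu hK (fh x fx).
Qed.

End FaceLattice.

(** * Contractions *)

Section Contraction.
Context {N : nat}.
Implicit Types (i j : 'I_N) (I J K L : {set 'I_N}) (s t : seq 'I_N) (e : ext N).

Local Notation contract := Defs.contract.

(** Arbitrary lists of indices allow induction; [contract J] is the case [s = enum J]. *)
Definition contract_seq s e : ext N := foldr contract1 e s.

(* For i in J this is the position of i in J, counted from 0. *)
Definition rank_in i J : nat := #|[set k in J | (k < i)%N]|.

Lemma index_sorted s i : sorted ltn (map val s) -> i \in s ->
  index i s = count (fun k : 'I_N => (k < i)%N) s.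
Proof.
elim: s => //= a s IH /[dup] /path_sorted ss sa; rewrite inE eq_sym.
have sa' : all (fun k : 'I_N => (a < k)%N) s.
  by have := order_path_min ltn_trans sa; rewrite all_map.
case: eqP => [<- _|_ /= si].
  rewrite ltnn add0n; apply/esym/eqP; rewrite -leqn0 leqNgt -has_count.
  apply/hasPn => k /(allP sa'); rewrite -leqNgt; exact: ltnW.
by rewrite (IH ss si) (allP sa' _ si).
Qed.

Lemma enum_filter J : enum J = [seq k <- enum 'I_N | k \in J].
Proof. by rewrite enumT. Qed.

Lemma index_enum_rank i J : i \in J -> index i (enum J) = rank_in i J.
Proof.
move=> iJ; rewrite index_sorted ?mem_enum //; last first.
  apply: (subseq_sorted ltn_trans (s2 := map val (enum 'I_N))).
    by apply: map_subseq; rewrite enum_filter; exact: filter_subseq.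
  by rewrite val_enum_ord; exact: iota_ltn_sorted.
rewrite /rank_in -size_filter cardE; congr size.
rewrite !enum_filter -filter_predI; apply: eq_filter => k /=.
by rewrite !inE andbC.
Qed.

Lemma rank_inD1 i J : rank_in i (J :\ i) = rank_in i J.
Proof.
rewrite /rank_in; congr #|pred_of_set _|; apply/setP => k; rewrite !inE.
by case: eqP => // ->; rewrite ltnn !andbF.
Qed.

(** Only the [I] with [I :\ i = J] contributes, namely [i |: J] when [i] is outside [J]. Identities
    between contractions thus become comparisons of signs. *)
Lemma contract1E i e J :
  contract1 i e J = if i \in J then 0 else (-1) ^+ rank_in i J * e (i |: J).
Proof.
rewrite /contract1 sum_ffunE.
have zE I : i \in I -> (eI (I :\ i) *~ ((-1) ^+ index i (enum I) * e I)) J =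
    if I :\ i == J then (-1) ^+ rank_in i J * e I else 0.
  move=> iI; rewrite ffunMzE ffunE eq_sym index_enum_rank //.
  case: eqP => [<-|_]; last by rewrite mul0rz.
  by rewrite rank_inD1 intz.
under eq_bigr => I iI do rewrite zE //.
rewrite -big_mkcondr /=.
have [iJ|iJ] := boolP (i \in J).
  rewrite big_pred0 // => I; apply/negP => /andP[_ /eqP IJ].
  by move: iJ; rewrite -IJ !inE eqxx.
rewrite (big_pred1 (i |: J)) // => I.
apply/andP/eqP => [[iI /eqP <-]|->]; first by rewrite finset.setD1K.
by rewrite finset.setU11 finset.setU1K.
Qed.

Lemma contract1D i e e' : contract1 i (e + e') = contract1 i e + contract1 i e'.
Proof.
apply/ffunP => J; rewrite [RHS]ffunE !contract1E.
by case: ifP => _; rewrite ?addr0 // ffunE mulrDr.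
Qed.

Lemma contract10 i : contract1 i 0 = 0 :> ext N.
Proof.
by apply/ffunP => J; rewrite contract1E !ffunE mulr0 if_same.
Qed.

Lemma contract1N i e : contract1 i (- e) = - contract1 i e.
Proof.
by apply/eqP; rewrite -subr_eq0 opprK -contract1D addNr contract10.
Qed.

Lemma contract1_sum i (A : Type) (r : seq A) (F : A -> ext N) :
  contract1 i (\sum_(a <- r) F a) = \sum_(a <- r) contract1 i (F a).
Proof.
by apply: (big_morph (contract1 i)); [exact: contract1D|exact: contract10].
Qed.

Lemma rank_inU1 i j J : j \notin J ->
  rank_in i (j |: J) = ((j < i) + rank_in i J)%N.
Proof.
move=> jJ; rewrite /rank_in.
have [ji|ji] := ltnP j i.
  have -> : [set k in j |: J | (k < i)%N] = j |: [set k in J | (k < i)%N].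
    by apply/setP => k; rewrite !inE; case: eqVneq => // ->; rewrite ji.
  by rewrite cardsU1 !inE (negPf jJ).
have -> // : [set k in j |: J | (k < i)%N] = [set k in J | (k < i)%N].
apply/setP => k; rewrite !inE; case: eqVneq => // ->.
by rewrite ltnNge ji !andbF.
Qed.

(** Exactly one of [i < j] and [j < i] holds, so inserting one index shifts the rank of the other in
    exactly one of the two orders. *)
Lemma contract1_anticomm i j e :
  contract1 i (contract1 j e) = - contract1 j (contract1 i e).
Proof.
apply/ffunP => J; rewrite [RHS]ffunE !contract1E !inE.
have [ij|ij] := eqVneq i j; first by rewrite ij ?eqxx /= mulr0 if_same oppr0.
rewrite /=.
have [iJ|iJ] := boolP (i \in J); first by rewrite mulr0 if_same oppr0.
have [jJ|jJ] := boolP (j \in J); first by rewrite mulr0 oppr0.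
rewrite !rank_inU1 // finset.setUCA !mulrA -mulNr; congr (_ * _).
rewrite -!exprD.
have [lt_ij|lt_ji|/val_inj eq_ij] := ltngtP i j;
  last by rewrite eq_ij eqxx in ij.
- by rewrite add0n add1n addnS exprS mulN1r addnC.
- by rewrite add0n add1n addnS exprS mulN1r opprK addnC.
Qed.

Lemma contract1_seq i s e : contract1 i (contract_seq s e) =
  if odd (size s) then - contract_seq s (contract1 i e)
  else contract_seq s (contract1 i e).
Proof.
elim: s => //= a s IH; rewrite contract1_anticomm IH.
by case: (odd (size s)); rewrite /= ?contract1N ?opprK.
Qed.

Lemma contract_seqC s t e : ~~ odd (size s) ->
  contract_seq s (contract_seq t e) = contract_seq t (contract_seq s e).
Proof.
by move=> s2; elim: t => //= i t <-; rewrite [RHS]contract1_seq (negPf s2).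
Qed.

(** Write S for the sum and T for the full contraction. Then S(a :: s) = T(a :: s) - a _| S(s), so S
    alternates between 0 and T. *)
Lemma sum_contract_rem s e : uniq s ->
  \sum_(i <- s) contract1 i (contract_seq (rem i s) e) =
  if odd (size s) then contract_seq s e else 0.
Proof.
elim: s => [|a s IH] /=; first by rewrite big_nil.
move=> /andP[as_ us]; rewrite big_cons eqxx.
have -> : \sum_(i <- s) contract1 i (contract_seq
    (if a == i then s else a :: rem i s) e) =
    - contract1 a (\sum_(i <- s) contract1 i (contract_seq (rem i s) e)).
  rewrite contract1_sum -sumrN big_seq [RHS]big_seq; apply: eq_bigr => i si.
  case: eqP => [ai|_]; first by rewrite ai si in as_.
  by rewrite /= contract1_anticomm.
rewrite IH //; case: (odd (size s)); rewrite /= ?subrr //.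
by rewrite contract10 subr0.
Qed.

Lemma contractE J e : contract J e = contract_seq (enum J) e.
Proof. by []. Qed.

Lemma contract_setC J K e : ~~ odd #|J| ->
  contract J (contract K e) = contract K (contract J e).
Proof. by rewrite cardE; exact: contract_seqC. Qed.

Lemma enum_setD1 J i : enum (J :\ i) = rem i (enum J).
Proof.
rewrite rem_filter ?enum_uniq // [LHS]enum_filter (enum_filter J).
rewrite -[RHS]filter_predI.
 by apply: eq_filter => k /=; rewrite !inE.
Qed.

Lemma sum_contractD1 J e : odd #|J| ->
  \sum_(i in J) contract1 i (contract (J :\ i) e) = contract J e.
Proof.
rewrite cardE => J1; rewrite -big_enum.
have := sum_contract_rem e (enum_uniq J); rewrite J1.
rewrite contractE => <-.
by apply: eq_bigr => i _; rewrite contractE enum_setD1.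
Qed.

Lemma contract_seq_local s e e' K :
  e (K :|: [set:: s]) = e' (K :|: [set:: s]) ->
  contract_seq s e K = contract_seq s e' K.
Proof.
elim: s K => [|a s IH] K /=; first by rewrite finset.set_nil finset.setU0.
rewrite finset.set_cons finset.setUCA => ee'; rewrite !contract1E.
case: ifP => // _.
congr (_ * _); apply: IH; rewrite -finset.setUA; exact: ee'.
Qed.

(** Allows a form to be replaced by a multiple of one basis element when a single coefficient of its
    contraction matters. *)
Lemma contract_local J e e' K : e (K :|: J) = e' (K :|: J) ->
  contract J e K = contract J e' K.
Proof.
move=> ee'; apply: contract_seq_local.
have -> : [set:: enum J] = J by apply/setP => i; rewrite inE mem_enum.
exact: ee'.
Qed.

Lemma contractMz J e m : contract J (e *~ m) = contract J e *~ m.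
Proof.
rewrite /contract; elim: (enum J) => //= i s ->; move: (foldr _ _ _) => e'.
have cM (n : nat) e0 : contract1 i (e0 *+ n) = contract1 i e0 *+ n.
  by elim: n => [|n IH]; rewrite ?mulr0n ?contract10 // !mulrS contract1D IH.
by case: m => n; rewrite ?NegzE ?mulrNz ?contract1N -!pmulrn cM.
Qed.

End Contraction.

(** * The differentials *)

Section Delta.
Context {R : realType} {n : nat} {X : manifoldWithCorners R n}.
Local Notation N := (nhyp X).
Local Notation face := (face X).
Local Notation chains := (chains X).
Local Notation contract := Defs.contract.
Implicit Types (f g : face) (J K L : {set 'I_N}) (e : ext N) (c : chains).

(* f_J *)
Definition face_minus f J : face :=
  projT1 (cid (unique_face_above (finset.subsetDl (face_index f) J))).

Lemma face_index_minus f J : face_index (face_minus f J) = face_index f :\: J.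
Proof. by rewrite /face_minus; case: cid => g []. Qed.

Lemma adherent_minus f J : adherent f (face_minus f J).
Proof. by rewrite /face_minus; case: cid => g []. Qed.

Lemma face_minus_unique f g J : adherent f g ->
  face_index g = face_index f :\: J -> g = face_minus f J.
Proof. rewrite /face_minus; case: cid => h [_ _ hu] /= fg gK; exact: hu. Qed.

(** The iterated face is adherent to [f] by transitivity and has the right index set; uniqueness
    concludes. *)
Lemma face_minus_minus f J K :
  face_minus (face_minus f J) K = face_minus f (J :|: K).
Proof.
apply: face_minus_unique; last by rewrite !face_index_minus finset.setDDl.
by apply: (@adherent_trans _ _ _ _ (face_minus f J)); apply: adherent_minus.
Qed.

Lemma face_minus0 f : face_minus f finset.set0 = f.
Proof.
by apply/esym/face_minus_unique; [exact: adherent_refl|rewrite finset.setD0].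
Qed.

Lemma codim_minus f J : J \subset face_index f ->
  codim (face_minus f J) = (codim f - #|J|)%N.
Proof.
by move=> Jf; rewrite -!card_face_index face_index_minus cardsDS.
Qed.

Lemma face_gap_minus f J : J \subset face_index f ->
  face_gap (face_minus f J) f = J.
Proof.
move=> Jf; rewrite /face_gap face_index_minus finset.setDDr finset.setDv.
by rewrite finset.set0U; apply/finset.setIidPr.
Qed.

Lemma symbolD f : {morph symbol f : e e' / e + e'}.
Proof. by move=> e e'; rewrite /symbol ffunE mulrzDr. Qed.

Lemma symbol0 f : symbol f 0 = 0.
Proof. by rewrite /symbol ffunE mulr0z. Qed.

Lemma symbol_sum f (T : Type) (r : seq T) (P : pred T) (F : T -> ext N) :
  symbol f (\sum_(t <- r | P t) F t) = \sum_(t <- r | P t) symbol f (F t).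
Proof. exact: (big_morph (symbol f) (symbolD f) (symbol0 f)). Qed.

Lemma face_of_codim p f : codim f = p -> exists A : open_faces X p, Face A = f.
Proof. by case: f => q A pq; case: _ / pq; exists A. Qed.

(** Sending [g] to [face_gap g f] is a bijection from the faces in the sum to the [k]-element
    subsets of [face_index f], with inverse [face_minus f]. *)
Lemma delta_symbolE k f e : delta_symbol k f e =
  \sum_(J : {set 'I_N} | (J \subset face_index f) && (#|J| == k))
     symbol (face_minus f J) (contract J e).
Proof.
rewrite /delta_symbol; case: leqP => [kf|fk]; last first.
  (* For [k > codim f] there is no subset with [k] elements, matching the value 0. *)
  rewrite big_pred0 // => J; apply/negP => /andP[/subset_leq_card].
  by rewrite card_face_index => Jf /eqP Jk; rewrite Jk leqNgt fk in Jf.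
pose P := [set g : open_faces X (codim f - k) |
  (face_set f `<=` closure (val g))%classic]%classic.
pose Q := [set J : {set 'I_N} |
  (J \subset face_index f) && (#|J| == k)]%classic.
have gapQ (g : open_faces X (codim f - k)) : P g -> Q (face_gap (Face g) f).
  move=> Pg; have fg : adherent f (Face g) by [].
  apply/andP; split; first exact: finset.subsetDl.
  rewrite /face_gap cardsDS ?adherent_index // !card_face_index.
  by rewrite /codim /= subKn.
have minus_gap (g : open_faces X (codim f - k)) : P g ->
    face_minus f (face_gap (Face g) f) = Face g.
  move=> Pg; have fg : adherent f (Face g) by [].
  apply/esym/face_minus_unique => //.
  rewrite /face_gap finset.setDDr finset.setDv finset.set0U.
  by apply/esym/finset.setIidPr; exact: adherent_index.
have gap_bij : set_bij P Q
    (fun g : open_faces X (codim f - k) => face_gap (Face g) f).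
  split=> //.
    move=> g h /set_mem Pg /set_mem Ph gh.
    have := minus_gap _ Ph; rewrite -gh minus_gap // => /eqP.
    by rewrite /Face eq_Tagged => /eqP.
  move=> J /andP[Jf /eqP Jk].
  have [|g gE] := @face_of_codim (codim f - k) (face_minus f J).
    by rewrite codim_minus // Jk.
  exists g; last by rewrite gE face_gap_minus.
  by have := @adherent_minus f J; rewrite -gE.
transitivity (\sum_(J \in Q) symbol (face_minus f J) (contract J e)).
  rewrite (reindex_fsbig _ _ _ _ gap_bij); apply: eq_fsbigr => g /set_mem Pg.
  by rewrite minus_gap.
by rewrite [RHS]bigfs ?index_enum_uniq // => J _; rewrite mem_index_enum.
Qed.

Lemma setDUK (T : finType) (A L : {set T}) : A \subset L -> L :\: A :|: A = L.
Proof.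
by move=> AL; rewrite finset.setUC -{1}(finset.setIidPr AL) finset.setID.
Qed.

Lemma symbol_eI f : symbol f (eI (face_index f)) = << f >>.
Proof. by rewrite /symbol ffunE eqxx. Qed.

Lemma symbolE f e : symbol f e = << f >> *~ e (face_index f).
Proof. by []. Qed.

Lemma delta_gen k f : delta k << f >> = delta_symbol k f (eI (face_index f)).
Proof. by rewrite -symbol_eI deltaE //; left. Qed.

(** Both sides see [e] only through its coefficient at [face_index f]. This allows a second [delta]
    to act on symbols with contracted forms. *)
Lemma delta_symbol_any k f e : delta k (symbol f e) = delta_symbol k f e.
Proof.
rewrite symbolE raddfMz /= delta_gen !delta_symbolE mulrz_suml.
apply: eq_bigr => J /andP[Jf _]; rewrite /symbol -mulrzA; congr (_ *~ _).
rewrite -mulrzz -ffunMzE -contractMz; apply: contract_local.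
rewrite face_index_minus setDUK //.
by rewrite ffunMzE ffunE eqxx intz.
Qed.

(** Removing [J] and then [A] leads to the face obtained by removing [L = J :|: A]; the terms are
    grouped by [L]. *)
Lemma delta_delta a b f : delta a (delta b << f >>) =
  \sum_(L : {set 'I_N} | (L \subset face_index f) && (#|L| == a + b)%N)
    symbol (face_minus f L)
      (\sum_(A : {set 'I_N} | (A \subset L) && (#|A| == a))
         contract A (contract (L :\: A) (eI (face_index f)))).
Proof.
set e := eI _; set I := face_index f.
rewrite delta_gen delta_symbolE raddf_sum /=.
transitivity (\sum_(J : {set 'I_N} | (J \subset I) && (#|J| == b))
    \sum_(A : {set 'I_N} | (A \subset I :\: J) && (#|A| == a))
       symbol (face_minus f (J :|: A)) (contract A (contract J e))).
  apply: eq_bigr => J _; rewrite delta_symbol_any delta_symbolE.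
  by rewrite face_index_minus; apply: eq_bigr => A _; rewrite face_minus_minus.
rewrite (exchange_big_dep (fun A : {set 'I_N} => #|A| == a)) /=; last first.
  by move=> J A _ /andP[].
transitivity (\sum_(A : {set 'I_N} | #|A| == a)
    \sum_(L : {set 'I_N} | [&& L \subset I, #|L| == (a + b)%N & A \subset L])
       symbol (face_minus f L) (contract A (contract (L :\: A) e))).
  apply: eq_bigr => A /eqP Aa.
  (* For fixed [A], the sets [J] disjoint from [A] correspond to the sets [L] containing [A]. *)
  rewrite (reindex_onto (fun L => L :\: A) (fun J => J :|: A)) /=; last first.
    move=> J /andP[_]; rewrite finset.subsetD => /andP[/andP[_ dAJ] _].
    rewrite finset.setDUl finset.setDv finset.setU0; apply/finset.setDidPl.
    by rewrite disjoint_sym.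
  symmetry; apply: eq_big => [L|L /and3P[_ _ AL]]; last first.
    by rewrite setDUK.
  have [AL|AL] := boolP (A \subset L); last first.
    rewrite !andbF; apply/esym/negbTE; apply: contra AL => /andP[_ /eqP <-].
    exact: finset.subsetUr.
  rewrite setDUK // -{1}(setDUK AL) finset.subUset finset.subsetD Aa !eqxx.
  rewrite !andbT.
  have -> : [disjoint A & L :\: A].
    by rewrite finset.disjoints_subset finset.setCD finset.subsetUr.
  have aL : (a <= #|L|)%N by rewrite -Aa subset_leq_card.
  rewrite cardsDS // Aa -(eqn_add2l a (_ - _)%N) subnKC //.
  by rewrite andbT -!andbA; congr (_ && _); rewrite andbC.
rewrite (exchange_big_dep (fun L : {set 'I_N} =>
  (L \subset I) && (#|L| == (a + b)%N))) /=; last first.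
  by move=> A L _ /and3P[-> ->].
apply: eq_bigr => L /andP[LI La]; rewrite symbol_sum; apply: eq_bigl => A.
by rewrite LI La andbC.
Qed.

Lemma delta1_delta b f : ~~ odd b ->
  delta 1 (delta b << f >>) = delta b.+1 << f >>.
Proof.
move=> b2; rewrite delta_delta delta_gen delta_symbolE; apply: eq_bigr => L.
move=> /andP[Lf /eqP Lb]; congr symbol; set e := eI _.
have L1 : odd #|L| by rewrite Lb.
rewrite -(sum_contractD1 e L1).
(* The one-element subsets of [L] are its singletons, which brings the sum to the form in
   [sum_contractD1]. *)
have <- : \sum_(A in [set [set i] | i in L]%SET)
    contract A (contract (L :\: A) e) =
  \sum_(i in L) contract1 i (contract (L :\ i) e).
  rewrite big_imset /=; last by move=> i j _ _; exact: finset.set1_inj.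
  by apply: eq_bigr => i _; rewrite /contract enum_set1.
apply: eq_bigl => A; apply/andP/imsetP => [[AL /cards1P[i Ai]]|[i iL ->]].
  by exists i => //; rewrite -finset.sub1set -Ai.
by rewrite finset.sub1set iL cards1.
Qed.

(** Passing to complements in [L] exchanges the two orders of composition, and a contraction by an
    even number of indices commutes with any other. *)
Lemma delta_delta1 b f : ~~ odd b ->
  delta b (delta 1 << f >>) = delta b.+1 << f >>.
Proof.
move=> b2; rewrite -(delta1_delta f b2) !delta_delta (addnC b).
apply: eq_bigr => L.
move=> /andP[_ /eqP Lb]; congr symbol; set e := eI _.
rewrite (reindex_onto (fun A => L :\: A) (fun A => L :\: A)) /=; last first.
  move=> A /andP[AL _]; rewrite finset.setDDr finset.setDv finset.set0U.
  exact/finset.setIidPr.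
apply: eq_big => [A|A /andP[/andP[AL /eqP Ab] /eqP LLA]]; last first.
  by rewrite LLA contract_setC // Ab.
have [AL|AL] := boolP (A \subset L); last first.
  apply/negbTE; apply: contra AL => /andP[_ /eqP <-]; exact: finset.subsetDl.
rewrite /= finset.subsetDl finset.setDDr finset.setDv finset.set0U.
rewrite (finset.setIidPr AL) eqxx andbT /= cardsDS // Lb.
have AL' := subset_leq_card AL; rewrite Lb in AL'.
by rewrite -(eqn_add2r #|A|) subnK // addnC eqn_add2l eq_sym.
Qed.

Lemma additive_eq_gen (V : zmodType) (u v : {additive chains -> V}) :
  (forall f, u << f >> = v << f >>) -> forall c, u c = v c.
Proof.
move=> uv c; rewrite -(freeg_sumE c) !raddf_sum; apply: eq_bigr => f _.
by rewrite -[coeff f c]intz -freegU_mulz !raddfMz /= uv.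
Qed.

Lemma delta1_deltaC b c : ~~ odd b -> delta 1 (delta b c) = delta b.+1 c.
Proof.
move=> b2; apply: (additive_eq_gen (u := delta 1 \o delta b)) => f /=.
exact: delta1_delta.
Qed.

Lemma delta_delta1C b c : ~~ odd b -> delta b (delta 1 c) = delta b.+1 c.
Proof.
move=> b2; apply: (additive_eq_gen (u := delta b \o delta 1)) => f /=.
exact: delta_delta1.
Qed.

Lemma delta0 c : delta 0 c = c.
Proof.
apply: (additive_eq_gen (u := delta 0) (v := idfun)) => f /=.
rewrite delta_gen delta_symbolE (big_pred1 finset.set0) => [|J].
  by rewrite face_minus0 /contract enum_set0 /= symbol_eI.
by rewrite cards_eq0 /=; case: eqVneq => [->|_]; rewrite ?finset.sub0set ?andbF.
Qed.

(** Common form of the parity grading and of the filtration by codimension. *)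
Definition supported (P : pred face) : {pred chains} :=
  [pred c : chains | all P (dom c)].

Lemma supported_zmod_closed P : zmod_closed (supported P).
Proof.
split=> [|c c' /allP Pc /allP Pc']; first by rewrite inE dom0.
by apply/allP => f /domB; rewrite mem_cat => /orP[/Pc|/Pc'].
Qed.

HB.instance Definition _ P := GRing.isZmodClosed.Build chains (supported P)
  (supported_zmod_closed P).

Lemma supported_gen (P : pred face) f : P f -> << f >> \in supported P.
Proof. by move=> Pf; rewrite inE domU1 /= Pf. Qed.

Lemma delta_supported (P Q : pred face) k c :
  (forall f J, P f -> J \subset face_index f -> #|J| = k ->
     Q (face_minus f J)) ->
  c \in supported P -> delta k c \in supported Q.
Proof.
move=> PQ /allP Pc; rewrite -(freeg_sumE c) raddf_sum big_seq.
apply: rpred_sum => f /Pc Pf.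
rewrite -[coeff f c]intz -freegU_mulz raddfMz /= rpredMz // delta_gen.
rewrite delta_symbolE; apply: rpred_sum => J /andP[Jf /eqP Jk].
by rewrite symbolE rpredMz // supported_gen // PQ.
Qed.

(* U *)
Definition delta_even c : chains := \sum_(k < N.+1) delta (2 * k) c.

Lemma delta_even_is_zmod_morphism : zmod_morphism delta_even.
Proof.
move=> c c'; rewrite /delta_even -sumrB; apply: eq_bigr => k _.
exact: raddfB.
Qed.

HB.instance Definition _ := GRing.isZmodMorphism.Build chains chains delta_even
  delta_even_is_zmod_morphism.

Lemma delta_pcn_delta1_even c : delta_pcn c = delta 1 (delta_even c).
Proof.
rewrite /delta_pcn /delta_even raddf_sum; apply: eq_bigr => k _.
by rewrite /= delta1_deltaC ?addn1 // mul2n odd_double.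
Qed.

Lemma delta_pcn_even_delta1 c : delta_pcn c = delta_even (delta 1 c).
Proof.
apply: eq_bigr => k _.
by rewrite delta_delta1C ?addn1 // mul2n odd_double.
Qed.

Lemma delta_even_parity b c :
  c \in chains_parity b -> delta_even c \in chains_parity b.
Proof.
move=> cb; apply: rpred_sum => k _.
apply: (delta_supported (P := fun f => odd (codim f) == b)) cb => f J fb Jf Jk.
(* The subtraction is not truncated, since [J] lies in [face_index f]. *)
rewrite codim_minus // Jk oddB ?oddM //=; first by rewrite addbF.
by rewrite -card_face_index -Jk subset_leq_card.
Qed.

Definition codim_below (m : nat) : pred face := fun f => (codim f < m)%N.

Lemma chains_below c : c \in supported (codim_below N.+1).
Proof.
apply/allP => f _; rewrite /codim_below /= ltnS -card_face_index.
by rewrite -[leqRHS]card_ord max_card.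
Qed.

(** The summand [k = 0] is the identity, and every other one removes a nonempty set of indices. *)
Lemma delta_even_unipotent m c : c \in supported (codim_below m.+1) ->
  delta_even c - c \in supported (codim_below m).
Proof.
move=> cm; rewrite /delta_even big_ord_recl delta0 addrC addKr.
apply: rpred_sum => k _; apply: delta_supported cm => f J fm Jf Jk.
rewrite /codim_below codim_minus // Jk.
have f0 : (0 < codim f)%N.
  by rewrite -card_face_index (leq_trans _ (subset_leq_card Jf)) ?Jk.
rewrite /codim_below ltnS in fm; apply: leq_trans fm.
by rewrite ltn_subrL f0.
Qed.

Lemma supported_below0 c : c \in supported (codim_below 0) -> c = 0.
Proof.
rewrite inE => /allP c0; apply/eqP; rewrite -dom_eq0.
by case: (dom c) c0 => // f s /(_ f (mem_head _ _)).
Qed.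

(** If U c = 0 then U c - c = - c, so [c] sinks one level in the filtration, again and again down to
    0. *)
Lemma delta_even_inj c : delta_even c = 0 -> c = 0.
Proof.
move=> c0; have := chains_below c; elim: N.+1 => [|m IH].
  exact: supported_below0.
by move=> /delta_even_unipotent; rewrite c0 sub0r rpredN.
Qed.

(** By induction on the level, U c - c = U c' for some [c'] of the same parity; then U (c - c') =
    c. *)
Lemma delta_even_surj b c : c \in chains_parity b ->
  exists2 c', c' \in chains_parity b & delta_even c' = c.
Proof.
have := chains_below c; elim: N.+1 c => [|m IH] c.
  by move=> /supported_below0 -> _; exists 0; rewrite ?rpred0 ?raddf0.
move=> /delta_even_unipotent cm cb.
have [|c' c'b Ec'] := IH _ cm; first by rewrite rpredB ?delta_even_parity.
by exists (c - c'); rewrite ?rpredB // raddfB /= Ec' subKr.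
Qed.

(** Here delta^pcn is written as U after delta^1, and U is injective. *)
Lemma cycles_delta_pcn b :
  cycles (@chains_parity R n X) (@delta R n X 1) b =i
  cycles (@chains_parity R n X) (@delta_pcn R n X) b.
Proof.
move=> c; rewrite !inE /= delta_pcn_even_delta1; congr (_ && _).
by apply/eqP/eqP => [->|/delta_even_inj]; rewrite ?raddf0.
Qed.

(** Here delta^pcn is written as delta^1 after U, and U maps the chains of each parity onto
    themselves. *)
Lemma boundaries_delta_pcn b :
  boundaries (@chains_parity R n X) (@delta R n X 1) b =i
  boundaries (@chains_parity R n X) (@delta_pcn R n X) b.
Proof.
move=> c; rewrite !inE; apply/asboolP/asboolP => -[y yb ->].
  have [z zb <-] := delta_even_surj yb.
  by exists z => //; rewrite /= delta_pcn_delta1_even.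
exists (delta_even y); first exact: delta_even_parity.
exact: delta_pcn_delta1_even.
Qed.

End Delta.

(** * Differentials with equal cycles and boundaries have isomorphic homology *)

Section HomologyEq.
Context {C : zmodType} (gr : bool -> zmodClosed C).

Lemma cycle_valB (d : {additive C -> C}) b (z z' : Defs.cycle gr d b) :
  cycle_val (z - z') = cycle_val z - cycle_val z'.
Proof. exact: (raddfB (val : Defs.cycle gr d b -> C)). Qed.

Lemma homology_class_eq (d : {additive C -> C}) b (z z' : Defs.cycle gr d b) :
  homology_class z = homology_class z' <->
  cycle_val z - cycle_val z' \in boundaries gr d b.
Proof.
rewrite -cycle_valB; split=> [/eqP|zz'].
  by rewrite -Quotient.idealrBE.
by apply/eqP; rewrite -Quotient.idealrBE.
Qed.

(** The two homology groups are distinct types, so the maps both ways are built from chosen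
    representatives; equality of the boundaries makes them independent of the choice. *)
Lemma identity_induces_isomorphism_of_eq (d d' : {additive C -> C}) :
  (forall b, cycles gr d b =i cycles gr d' b) ->
  (forall b, boundaries gr d b =i boundaries gr d' b) ->
  identity_induces_isomorphism gr d d'.
Proof.
move=> Ecyc Ebnd b; split; first by move=> c; rewrite Ecyc.
  by move=> c; rewrite Ebnd.
have fP (z : Defs.cycle gr d b) : cycle_val z \in cycles gr d' b.
  by rewrite -Ecyc; exact: cycleP.
have gP (z : Defs.cycle gr d' b) : cycle_val z \in cycles gr d b.
  by rewrite Ecyc; exact: cycleP.
pose f (h : homology gr d b) : homology gr d' b :=
  homology_class (Cycle (fP (repr h))).
pose g (h : homology gr d' b) : homology gr d b :=
  homology_class (Cycle (gP (repr h))).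
have reprK d0 (h : homology gr d0 b) : homology_class (repr h) = h.
  exact: reprK.
(* The chosen representative differs from [z] by a boundary of [d], which is also one of [d']. *)
have fE (z : Defs.cycle gr d b) (z' : Defs.cycle gr d' b) : z = z' :> C ->
    f (homology_class z) = homology_class z'.
  move=> zz'; rewrite /f; apply/homology_class_eq; rewrite -Ebnd -zz'.
  by rewrite /=; apply/homology_class_eq; exact: reprK.
have gE (z : Defs.cycle gr d b) (z' : Defs.cycle gr d' b) : z = z' :> C ->
    g (homology_class z') = homology_class z.
  move=> zz'; rewrite /g; apply/homology_class_eq; rewrite Ebnd zz'.
  by rewrite /=; apply/homology_class_eq; exact: reprK.
have f_additive : zmod_morphism f.
  move=> h h'; rewrite -(reprK _ h) -(reprK _ h').
  have -> : homology_class (repr h) - homology_class (repr h') =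
      homology_class (repr h - repr h').
    by rewrite /homology_class raddfB.
  (* The difference of representatives is viewed as a cycle of [d'], where taking classes is
     additive. *)
  rewrite (fE _ (Cycle (fP (repr h)) - Cycle (fP (repr h')))); last first.
    by rewrite !cycle_valB.
  rewrite (fE _ (Cycle (fP (repr h)))) // (fE _ (Cycle (fP (repr h')))) //.
  by rewrite /homology_class raddfB.
pose F := GRing.isZmodMorphism.Build _ _ f f_additive.
pose phi : {additive homology gr d b -> homology gr d' b} := HB.pack f F.
exists phi; last exact: fE.
exists g => h.
  rewrite -(reprK _ h) /= (fE _ (Cycle (fP (repr h)))) //; exact: gE.
rewrite -(reprK _ h) (gE (Cycle (gP (repr h)))) //; exact: fE.
Qed.

End HomologyEq.

Theorem proposition7p2 (R : realType) (n : nat) (X : manifoldWithCorners R n)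
    (d : nat) (Xconnected : connected (points X)) (Xd : has_codimension X d) :
  @identity_induces_isomorphism (chains X) (@chains_parity R n X)
    (@delta R n X 1) (@delta_pcn R n X).
Proof.
apply: identity_induces_isomorphism_of_eq => b.
- exact: cycles_delta_pcn.
- exact: boundaries_delta_pcn.
Qed.
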